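(* For every positive integer $n$, $|S_n(\alpha_1,\alpha_2,\tau)|=\binom{n}{2}+1$ in each of the following cases: (1) $\alpha_1=123$, $\alpha_2=231$, and $\tau\in S_4$ contains $123$ or $231$; (2) $\alpha_1=123$, $\alpha_2\in\{132,213\}$, and $\tau\in\{3412,4231\}$; (3) $(\alpha_1,\alpha_2,\tau)=(132,213,3412)$; (4) $\alpha_1=132$, $\alpha_2=231$, and $\tau\in\{1234,2134,3124,3214\}$; (5) $(\alpha_1,\alpha_2,\tau)=(213,312,2341)$; (6) $\alpha_1=213$, $\alpha_2=321$, and $\tau\in\{1324,2314\}$; (7) $(\alpha_1,\alpha_2,\tau)=(213,132,4321)$.
   Context: Permutations are written in one-line notation. A permutation $\sigma\in S_n$ contains $\pi\in S_m$ if there are indices $i_1<\dots<i_m$ such that for all $j<l$, $\sigma_{i_j}<\sigma_{i_l}$ iff $\pi_j<\pi_l$; otherwise $\sigma$ avoids $\pi$. $S_n(\pi^{(1)},\dots,\pi^{(r)})$ is the set of permutations in $S_n$ avoiding all the listed patterns. *)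

(* Defs.v *)
From mathcomp Require Import all_boot all_fingroup.
Set Implicit Arguments. Unset Strict Implicit. Unset Printing Implicit Defensive.

(* Words / patterns are sequences of natural numbers; a permutation in S_n is
   represented by its one-line notation [s(1); ...; s(n)] with values 1..n. *)

Definition order_iso (a b : seq nat) : bool :=
  (size a == size b) &&
  [forall j : 'I_(size b), forall l : 'I_(size b),
     (j < l) ==> ((nth 0 a j < nth 0 a l) == (nth 0 b j < nth 0 b l))].

Definition contains (w p : seq nat) : bool :=
  [exists m : (size w).-tuple bool, order_iso (mask m w) p].

Definition avoids (w p : seq nat) : bool := ~~ contains w p.

Definition oneline n (s : 'S_n) : seq nat := [seq (s i).+1 | i <- enum 'I_n].

Definition Av n (ps : seq (seq nat)) : {set 'S_n} :=
  [set s : 'S_n | all (avoids (oneline s)) ps].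

(* Main.v *)
Require Import Defs.
From mathcomp Require Import all_boot all_fingroup.
From mathcomp Require Import zify.
Set Implicit Arguments. Unset Strict Implicit. Unset Printing Implicit Defensive.

(** Insert the maximum: every permutation of size n+1 is [u ++ (n+1) :: v] for a
    unique permutation [u ++ v] of size n.  For a pattern [p1 ++ q :: p2] with maximum
    q, the word [u ++ m :: v] contains it iff [u ++ v] does or [p1 ++ p2] occurs with
    its [p1] part in [u] and its [p2] part in [v].  In each class this either puts the
    maximum at a fixed place (first, second, last or just after the previous maximum)
    with no new condition beyond avoiding a shorter pattern,
    or forces u and v to be monotone and one to lie above the other, which leaves a
    single word for each position.  Hence |S_(n+1)| = |S_n| + n, where for some classes
    the summand n counts an auxiliary class itself given by |T_(n+1)| = |T_n| + 1.
    The remaining classes follow by reverse-complement. *)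

(** * Occurrences of patterns *)

Definition agree (p q : nat * nat) : bool := (p.1 < q.1) == (p.2 < q.2).

(** A list form of [order_iso]: pairing each letter with its pattern letter allows induction on
    words and the library of [pairwise]. *)
Definition oiso (a b : seq nat) : bool :=
  (size a == size b) && pairwise agree (zip a b).

Lemma order_isoE : order_iso =2 oiso.
Proof.
move=> a b; rewrite /order_iso /oiso; case: eqP => //= sab.
have szz : size (zip a b) = size b by rewrite size_zip sab minnn.
apply/idP/(pairwiseP (0, 0)).
  move=> /forallP H i j; rewrite !inE !szz => ib jb ij.
  have := H (Ordinal ib) => /forallP /(_ (Ordinal jb)) /implyP /(_ ij).
  by rewrite !nth_zip //.
move=> H; apply/forallP => i; apply/forallP => j; apply/implyP => ij.
have := H i j; rewrite !inE !szz !ltn_ord => /(_ isT isT ij).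
by rewrite !nth_zip.
Qed.

Lemma oiso_cons x a y b :
  oiso (x :: a) (y :: b) = all (agree (x, y)) (zip a b) && oiso a b.
Proof. by rewrite /oiso /= eqSS andbCA. Qed.

Lemma containsP w p :
  reflect (exists2 a, subseq a w & oiso a p) (contains w p).
Proof.
apply: (iffP existsP) => [[m H] | [a /subseqP [m sm ->] H]].
  by exists (mask m w); rewrite ?mask_subseq // -order_isoE.
by exists (Tuple (introT eqP sm)); rewrite order_isoE.
Qed.

(** An explicit enumeration, so that containment between concrete patterns is settled by evaluation;
    the quantifier over tuples in [contains] does not compute. *)
Fixpoint subseqs (s : seq nat) : seq (seq nat) :=
  if s is x :: s' then map (cons x) (subseqs s') ++ subseqs s' else [:: [::]].

Lemma mem_subseqs s a : (a \in subseqs s) = subseq a s.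
Proof.
elim: s a => [|x s IH] a; first by rewrite subseq0 inE.
rewrite /= mem_cat IH; case: a => [|y a].
  by rewrite sub0seq orbT.
case: eqP => [->|yx].
  rewrite mem_map; last by move=> ? ? [].
  rewrite IH; apply/orP/idP => [[//|]|]; last by left.
  exact: cons_subseq.
apply/orP/idP => [[/mapP[b _ [yx' _]]|//]|]; last by right.
by case: yx.
Qed.

Lemma containsE w p : contains w p = has (oiso^~ p) (subseqs w).
Proof.
apply/containsP/hasP => -[a]; rewrite ?mem_subseqs => H1 H2; exists a => //.
by rewrite mem_subseqs.
Qed.

Lemma oiso_mask m a b : oiso a b -> oiso (mask m a) (mask m b).
Proof.
case/andP=> /eqP sab Hp; apply/andP; split.
  by elim: m a b sab {Hp} => [|[] m IH] [|x a] [|y b] //= [] /IH // /eqP ->.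
have -> : zip (mask m a) (mask m b) = mask m (zip a b).
  elim: m a b sab {Hp} => [|[] m IH] [|x a] [|y b] //= [] /IH // -> //.
exact: pairwise_mask.
Qed.

Lemma oiso_trans a b c : oiso a b -> oiso b c -> oiso a c.
Proof.
elim: a b c => [|x a IH] [|y b] [|z c] //.
rewrite !oiso_cons => /andP[H1 ab] /andP[H2 bc].
rewrite (IH _ _ ab bc) andbT.
elim: a b c {IH} ab bc H1 H2 => [|x' a IH] [|y' b] [|z' c] //=.
rewrite !oiso_cons => /andP[_ ab] /andP[_ bc] /andP[/eqP /= h1 H1] /andP[/eqP /= h2 H2].
by rewrite (IH _ _ ab bc H1 H2) andbT /agree /= h1 h2.
Qed.

Lemma contains_trans p w q : contains w p -> contains p q -> contains w q.
Proof.
case/containsP=> a aw ap /containsP[b /subseqP[m _ ->] bq].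
apply/containsP; exists (mask m a).
  exact: subseq_trans (mask_subseq _ _) aw.
exact: oiso_trans (oiso_mask m ap) bq.
Qed.

Lemma avoids_mono p w q : contains p q -> avoids w q -> avoids w p.
Proof. by move=> pq; apply: contra => wp; apply: contains_trans pq. Qed.

Lemma subseq_catP (s u v : seq nat) : subseq s (u ++ v) ->
  exists s1 s2, [/\ s = s1 ++ s2, subseq s1 u & subseq s2 v].
Proof.
elim: u s => [|x u IH] s /=; first by exists [::], s.
case: s => [|y s]; first by exists [::], [::]; rewrite sub0seq.
case: eqP => [->|yx] /IH [s1 [s2 [-> h1 h2]]].
  by exists (x :: s1), s2; rewrite /= eqxx.
exists s1, s2; split => //; exact: subseq_trans h1 (subseq_cons _ _).
Qed.

(** An occurrence of [p1 ++ p2] in [u ++ v] cut at the prescribed place; the equation on sizes fixes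
    where the pattern is cut. *)
Definition occ2 u v p1 p2 : Prop :=
  exists a b, [/\ subseq a u, subseq b v, size a = size p1 & oiso (a ++ b) (p1 ++ p2)].


(** Maxima must be matched. If [m] came before the place of [q], the letter matched with [q] would
    exceed [m]; if it came after, the pattern letter matched with [m] would exceed [q]. *)
Lemma oiso_max_pos a b p1 p2 m q :
  all (ltn^~ m) (a ++ b) -> all (ltn^~ q) (p1 ++ p2) ->
  oiso (a ++ m :: b) (p1 ++ q :: p2) -> size a = size p1.
Proof.
elim: a p1 => [|x a IH] [|y p1] //=.
- move=> Hb /andP[yq _]; rewrite oiso_cons => /andP[/(all_nthP (0, 0)) H].
  case/andP=> /eqP; rewrite size_cat /= => sb _.
  have := H (size p1); rewrite size_zip sb size_cat minnn /= addnS ltnS leq_addr => /(_ isT).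
  rewrite nth_zip ?sb ?size_cat // nth_cat ltnn subnn /agree /= yq eqb_id => mb.
  have : nth 0 b (size p1) < m by apply: (all_nthP 0 Hb); lia.
  by move/(ltn_trans mb); rewrite ltnn.
- case/andP=> xm _ Hp; rewrite oiso_cons => /andP[/(all_nthP (0, 0)) H].
  case/andP=> /eqP; rewrite size_cat /= => sb _.
  have := H (size a); rewrite size_zip -sb size_cat minnn /= addnS ltnS leq_addr => /(_ isT).
  rewrite nth_zip ?size_cat // nth_cat ltnn subnn /agree /= xm => /eqP /esym qb.
  have : nth 0 p2 (size a) < q by apply: (all_nthP 0 Hp); lia.
  by move/(ltn_trans qb); rewrite ltnn.
case/andP=> xm Ha /andP[yq Hp]; rewrite oiso_cons => /andP[_ H].
by rewrite (IH _ Ha Hp H).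
Qed.

(** Every comparison with the inserted maxima has the same outcome on both sides: true for earlier
    letters, false for later ones. *)
Lemma oiso_insmax a b p1 p2 m q :
  all (ltn^~ m) (a ++ b) -> all (ltn^~ q) (p1 ++ p2) -> size a = size p1 ->
  oiso (a ++ m :: b) (p1 ++ q :: p2) = oiso (a ++ b) (p1 ++ p2).
Proof.
elim: a p1 => [|x a IH] [|y p1] //=.
- move=> Ha Hp _; rewrite oiso_cons; case: (boolP (oiso b p2)) => E; rewrite ?andbF ?andbT //.
  elim: b p2 Ha Hp {E} => [|x b IH] [|y p2] //= /andP[xm Hb] /andP[yq Hp].
  rewrite (IH _ Hb Hp) andbT /agree /=; lia.
- move=> /andP[xm Ha] /andP[yq Hp] [sz].
  rewrite !oiso_cons (IH _ Ha Hp sz) !zip_cat // !all_cat /=.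
  by rewrite {2}/agree /= xm yq eqxx.
Qed.

(** An occurrence either skips [m] or uses it; in the latter case [m] plays [q], and deleting both
    leaves an occurrence cut exactly where [m] stood. *)
Lemma containsP_insmax u v m p1 q p2 :
  all (ltn^~ m) (u ++ v) -> all (ltn^~ q) (p1 ++ p2) ->
  contains (u ++ m :: v) (p1 ++ q :: p2) <->
  contains (u ++ v) (p1 ++ q :: p2) \/ occ2 u v p1 p2.
Proof.
move=> Hm Hq.
have sub_all a b : subseq a u -> subseq b v -> all (ltn^~ m) (a ++ b).
  move=> au bv; apply/allP => x /(mem_subseq (cat_subseq au bv)).
  exact: (allP Hm).
split=> [/containsP[s /subseq_catP[a [b [-> au]]]]|[]].
- case: b => [|y b] bv.
    move=> H; left; apply/containsP; exists (a ++ [::]) => //.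
    by apply: cat_subseq => //; apply: sub0seq.
  move: bv => /=; case: eqP => [-> bv H|_ bv H].
    right; exists a, b.
    have Hab := sub_all _ _ au bv.
    have sz := oiso_max_pos Hab Hq H.
    by rewrite -(oiso_insmax Hab Hq sz).
  left; apply/containsP; exists (a ++ y :: b) => //; exact: cat_subseq.
- case/containsP => s sw sp; apply/containsP; exists s => //.
  apply: subseq_trans sw _; apply: cat_subseq => //; exact: subseq_cons.
- case=> a [b [au bv sz H]]; apply/containsP; exists (a ++ m :: b).
    by apply: cat_subseq => //=; rewrite eqxx.
  by rewrite oiso_insmax // sub_all.
Qed.

Lemma occ2_nill u v p : occ2 u v [::] p <-> contains v p.
Proof.
split=> [[a [b [_ bv /size0nil -> H]]]|/containsP[b bv H]].
  by apply/containsP; exists b.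
by exists [::], b; rewrite sub0seq.
Qed.

Lemma oiso_size a b : oiso a b -> size a = size b.
Proof. by case/andP => /eqP. Qed.

Lemma occ2_nilr u v p : occ2 u v p [::] <-> contains u p.
Proof.
split=> [[a [b [au bv sz H]]]|/containsP[a au H]].
  move: (oiso_size H); rewrite !size_cat sz => /addnI /size0nil b0.
  by apply/containsP; exists a => //; rewrite b0 !cats0 in H.
by exists a, [::]; rewrite sub0seq !cats0; split => //; apply: oiso_size.
Qed.

Lemma occ2_11 u v x y : occ2 u v [:: x] [:: y] <->
  exists a b, [/\ a \in u, b \in v & (a < b) = (x < y)].
Proof.
split=> [[a [b [au bv sz H]]]|[a [b [au bv H]]]]; last first.
  by exists [:: a], [:: b]; rewrite !sub1seq /oiso /= /agree /= H eqxx.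
move: (oiso_size H); rewrite !size_cat sz => -[].
case: a sz au H => [|a []] //= _ au; case: b bv => [|b []] // bv H _.
exists a, b; rewrite -!sub1seq; split => //.
by move: H; rewrite /oiso /= /agree /= !andbT => /eqP.
Qed.

(* [true] codes increasing, or below; [false] codes decreasing, or above. *)
Definition rel_of (b : bool) : rel nat := if b then ltn else gtn.

(** The rigid shape forced by the patterns: for a permutation of 1..n it is determined by the size
    of [u]. *)
Definition split_mono b1 b2 b3 (u v : seq nat) : bool :=
  [&& pairwise (rel_of b1) u, pairwise (rel_of b2) v & allrel (rel_of b3) u v].

Lemma oiso_rel b a p : uniq p -> oiso a p -> pairwise (rel_of b) a -> pairwise (rel_of b) p.
Proof.
elim: p a => [|y p IH] [|x a] //=.
rewrite oiso_cons => /andP[yp up] /andP[H Ho] /andP[Ha /(IH _ up Ho) ->].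
rewrite andbT; move/oiso_size: Ho; elim: p a yp H Ha {IH up} => [|y' p IH] [|x' a] //=.
rewrite inE negb_or /agree => /andP[/= yy yp] /andP[h H] /andP[xx Ha] [sz].
rewrite (IH _ yp H Ha sz) andbT; move: h xx yy; rewrite /rel_of; case: b {IH Ha}; rewrite /=; lia.
Qed.

Lemma oiso_split_size a b p : oiso (a ++ b) p -> exists p1 p2,
  [/\ p = p1 ++ p2, size a = size p1 & size b = size p2].
Proof.
move/oiso_size; rewrite size_cat => sz.
exists (take (size a) p), (drop (size a) p); rewrite cat_take_drop size_drop size_takel; last by lia.
split => //; lia.
Qed.

Lemma oiso_cat a1 a2 p1 p2 : size a1 = size p1 -> oiso (a1 ++ a2) (p1 ++ p2) ->
  [/\ oiso a1 p1, oiso a2 p2 & allrel agree (zip a1 p1) (zip a2 p2)].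
Proof.
move=> sz /andP[]; rewrite !size_cat sz eqn_add2l zip_cat // pairwise_cat.
by move=> s2 /and3P[h1 h2 h3]; rewrite /oiso sz eqxx s2 h2 h3.
Qed.

Lemma oiso_split_mono b1 b2 b3 a1 a2 p1 p2 : size a1 = size p1 ->
  uniq (p1 ++ p2) -> oiso (a1 ++ a2) (p1 ++ p2) ->
  split_mono b1 b2 b3 a1 a2 -> split_mono b1 b2 b3 p1 p2.
Proof.
move=> sz; rewrite cat_uniq => /and3P[u1 u12 u2] /(oiso_cat sz) [o1 o2 o12].
case/and3P=> h1 h2 h3; apply/and3P; split; [exact: oiso_rel h1|exact: oiso_rel h2|].
have s2 := oiso_size o2.
(* Words and patterns are written as the two projections of the same zips, so that all relations
   range over matched pairs. *)
rewrite -(unzip1_zip (eq_leq sz)) -(unzip1_zip (eq_leq s2)) allrel_mapl allrel_mapr in h3.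
rewrite -[p1](unzip2_zip (eq_leq (esym sz))) -[p2](unzip2_zip (eq_leq (esym s2))).
rewrite allrel_mapl allrel_mapr; apply/allrelP => p q pz qz.
have/allrelP/(_ p q pz qz) := h3; have/allrelP/(_ p q pz qz) := o12.
have yq : p.2 != q.2.
  apply: contraNneq u12 => e; apply/hasP; exists q.2.
    by rewrite -(unzip2_zip (eq_leq (esym s2))) map_f.
  by rewrite -e -(unzip2_zip (eq_leq (esym sz))) map_f.
by move: yq; rewrite /agree /rel_of; case: b3 {h3} => /=; lia.
Qed.

Lemma split_mono_subseq b1 b2 b3 u v a b : subseq a u -> subseq b v ->
  split_mono b1 b2 b3 u v -> split_mono b1 b2 b3 a b.
Proof.
move=> au bv /and3P[h1 h2 h3]; rewrite /split_mono (subseq_pairwise au h1) (subseq_pairwise bv h2).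
by case/subseqP: au => ? _ ->; case/subseqP: bv => ? _ ->; rewrite allrel_maskl ?allrel_maskr.
Qed.

(** An occurrence would cut [p] at some place and pass the split shape on to the two pieces. For a
    concrete [p] the finite check over all cuts is evaluated. *)
Lemma split_mono_avoids b1 b2 b3 u v p : uniq p -> split_mono b1 b2 b3 u v ->
  all (fun k => ~~ split_mono b1 b2 b3 (take k p) (drop k p)) (iota 0 (size p).+1) ->
  avoids (u ++ v) p.
Proof.
move=> up Hs /allP H; apply/negP => /containsP[s /subseq_catP[a [b [-> au bv]]] Ho].
have [p1 [p2 [Ep s1 s2]]] := oiso_split_size Ho.
move: up Ho H; rewrite Ep => up Ho /(_ (size p1)).
rewrite mem_iota size_cat /= ltnS leq_addr => /(_ isT).
rewrite take_size_cat // drop_size_cat //.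
by rewrite (oiso_split_mono s1 up Ho (split_mono_subseq au bv Hs)).
Qed.

(** * Counting by insertion of the maximum *)

Definition cnt n (P : pred (seq nat)) := count P (permutations (iota 1 n)).

Lemma eq_cnt n P Q : (forall w, perm_eq w (iota 1 n) -> P w = Q w) -> cnt n P = cnt n Q.
Proof. by move=> H; apply: eq_in_count => w; rewrite mem_permutations => /H. Qed.

Lemma cnt_pred1 n w0 : perm_eq w0 (iota 1 n) -> cnt n (pred1 w0) = 1.
Proof. by move=> H; rewrite /cnt count_uniq_mem ?permutations_uniq // mem_permutations H. Qed.

Lemma cnt_pred0 n : cnt n pred0 = 0.
Proof. exact: count_pred0. Qed.

Lemma perm_oneline n (s : 'S_n) : perm_eq (oneline s) (iota 1 n).
Proof.
rewrite /oneline; apply: uniq_perm.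
- by rewrite map_inj_uniq ?enum_uniq // => i j [] /val_inj /perm_inj.
- exact: iota_uniq.
move=> x; rewrite mem_iota; apply/mapP/idP => [[i _ ->]|/andP[x0 xn]].
  by rewrite /= add1n ltnS ltn_ord.
have xn' : x.-1 < n by lia.
exists ((s^-1)%g (Ordinal xn')); first by rewrite mem_enum.
by rewrite permKV /=; lia.
Qed.

Lemma oneline_inj n : injective (@oneline n).
Proof.
move=> s t /eq_in_map H; apply/permP => i.
by have /(_ (mem_enum _ _)) [] := H i => /val_inj.
Qed.

(** One-line notation is injective into a list of n! words, hence exhausts it, and the count moves
    from ['S_n] to words. *)
Lemma card_Av n ps : #|Av n ps| = cnt n (fun w => all (avoids w) ps).
Proof.
have Hs : map (@oneline n) (enum 'S_n) =i permutations (iota 1 n).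
  apply: (uniq_min_size _ _ _).2.
  - by rewrite map_inj_uniq ?enum_uniq //; apply: oneline_inj.
  - by move=> w /mapP[s _ ->]; rewrite mem_permutations perm_oneline.
  by rewrite size_permutations ?iota_uniq // size_iota size_map -cardE card_Sn.
have : perm_eq (map (@oneline n) (enum 'S_n)) (permutations (iota 1 n)).
  apply: uniq_perm => //; last exact: permutations_uniq.
  by rewrite map_inj_uniq ?enum_uniq //; apply: oneline_inj.
move/seq.permP => /(_ (fun w => all (avoids w) ps)); rewrite /cnt => <-.
rewrite count_map cardE [in RHS]enumT /enum_mem size_filter.
by apply: eq_count => s; rewrite /= inE.
Qed.

Definition ins i m (w : seq nat) := take i w ++ m :: drop i w.

Lemma perm_size_iota w n : perm_eq w (iota 1 n) -> size w = n.
Proof. by move/perm_size; rewrite size_iota. Qed.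

(** The index of the letter [n.+1] recovers the place, and deleting that letter recovers the
    word. *)
Lemma ins_inj n i j w w' : i <= n -> j <= n ->
  perm_eq w (iota 1 n) -> perm_eq w' (iota 1 n) ->
  ins i n.+1 w = ins j n.+1 w' -> i = j /\ w = w'.
Proof.
move=> ni nj Hw Hw' E.
have ix k u : k <= n -> perm_eq u (iota 1 n) -> index n.+1 (ins k n.+1 u) = k.
  move=> kn Hu; rewrite /ins index_cat /= eqxx addn0 size_takel ?(perm_size_iota Hu) //.
  case: ifP => // /mem_take; rewrite (perm_mem Hu) mem_iota; lia.
have eij : i = j by rewrite -(ix i w) // E ix.
split=> //; move: E; rewrite -eij /ins.
move/eqP; rewrite eqseq_cat ?size_takel ?(perm_size_iota Hw) ?(perm_size_iota Hw') //.
case/andP => /eqP E1 /eqP [E2]; by rewrite -(cat_take_drop i w) E1 E2 cat_take_drop.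
Qed.

Lemma perm_ins i m w : perm_eq (ins i m w) (m :: w).
Proof. by rewrite /ins -cat_rcons -cats1 -catA -[in X in perm_eq _ X](cat_take_drop i w) perm_catCA. Qed.

Lemma perm_iota_rcons n : perm_eq (n.+1 :: iota 1 n) (iota 1 n.+1).
Proof. by rewrite -[in iota 1 n.+1](addn1 n) iotaD add1n cats1 perm_sym perm_rcons. Qed.

(** The (n+1) * n! insertions are distinct permutations of 1..n+1, so by cardinality they are all of
    them. *)
Lemma cnt_insert n P : cnt n.+1 P = \sum_(i < n.+1) cnt n (fun w => P (ins i n.+1 w)).
Proof.
pose L := [seq ins i n.+1 w | i <- iota 0 n.+1, w <- permutations (iota 1 n)].
have uL : uniq L.
  apply: allpairs_uniq; rewrite ?iota_uniq ?permutations_uniq //.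
  move=> p p' /allpairsP[[i w] [Hi Hw ->]] /allpairsP[[j w'] [Hj Hw' ->]].
  move: Hi Hw Hj Hw'; rewrite !mem_permutations !mem_iota /= !add0n !ltnS => Hi Hw Hj Hw'.
  by case/(ins_inj Hi Hj Hw Hw') => -> ->.
have sL : {subset L <= permutations (iota 1 n.+1)}.
  move=> w /allpairsP[[i v] /= [_]]; rewrite !mem_permutations => Hv ->.
  apply: perm_trans (perm_ins _ _ _) _; apply: perm_trans _ (perm_iota_rcons n).
  by rewrite perm_cons.
have eL := (uniq_min_size uL sL _).2.
have HL : perm_eq L (permutations (iota 1 n.+1)).
  apply: uniq_perm; rewrite ?permutations_uniq //; apply: eL.
  by rewrite size_allpairs !size_permutations ?iota_uniq // !size_iota factS.
move/seq.permP: HL => /(_ P); rewrite /cnt => <-.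
rewrite /L count_flatten sumnE !big_map -[iota 0 _]/(index_iota 0 n.+1) big_mkord.
by apply: eq_bigr => i _; rewrite count_map.
Qed.

(* Reversing the decreasing blocks and putting the lower block first turns a split_mono
   word into the identity word. *)
Definition straighten b1 b2 b3 (u v : seq nat) :=
  let u' := if b1 then u else rev u in
  let v' := if b2 then v else rev v in
  if b3 then u' ++ v' else v' ++ u'.

Lemma pairwise_rel_rev b u : pairwise (rel_of b) u = pairwise ltn (if b then u else rev u).
Proof.
case: b => //; rewrite /rel_of.
by elim: u => //= x u ->; rewrite rev_cons pairwise_rcons all_rev.
Qed.

Lemma split_mono_straighten b1 b2 b3 u v : split_mono b1 b2 b3 u v = pairwise ltn (straighten b1 b2 b3 u v).
Proof.
rewrite /split_mono /straighten !pairwise_rel_rev.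
set u' := if b1 then _ else _; set v' := if b2 then _ else _.
have -> : allrel (rel_of b3) u v = allrel (rel_of b3) u' v'.
  by rewrite /u' /v'; case: (b1); case: (b2); rewrite ?allrel_revl ?allrel_revr.
case: b3; rewrite pairwise_cat andbA andbC //.
by rewrite allrelC [pairwise _ u' && _]andbC.
Qed.

Lemma perm_straighten b1 b2 b3 u v : perm_eq (straighten b1 b2 b3 u v) (u ++ v).
Proof.
have Hr b (w : seq nat) : perm_eq (if b then w else rev w) w.
  by case: b; rewrite ?perm_rev.
rewrite /straighten; case: b3; last rewrite perm_catC; exact: perm_cat.
Qed.

(** Straightening such a word yields the increasing word on 1..n, and the known block sizes allow
    this to be undone, so the word is unique. *)
Lemma cnt_split_mono b1 b2 b3 n i : i <= n ->
  cnt n (fun w => split_mono b1 b2 b3 (take i w) (drop i w)) = 1.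
Proof.
move=> ni.
(* The blocks take complementary intervals of values, the lower block starting at 1; [u] and [v]
   list them in the direction set by [b1] and [b2]. *)
pose s := if b3 then iota 1 i else iota (n - i).+1 i.
pose t := if b3 then iota i.+1 (n - i) else iota 1 (n - i).
pose u := if b1 then s else rev s; pose v := if b2 then t else rev t.
have est : straighten b1 b2 b3 u v = iota 1 n.
  have e1 : iota 1 i ++ iota i.+1 (n - i) = iota 1 n by rewrite -(add1n i) -iotaD subnKC.
  have e2 : iota 1 (n - i) ++ iota (n - i).+1 i = iota 1 n by rewrite -(add1n (n - i)) -iotaD subnK.
  rewrite /straighten /u /v /s /t.
  by case: (b1); case: (b2); case: (b3); rewrite ?revK.
have su : size u = i by rewrite /u /s; case: (b1); case: (b3); rewrite ?size_rev size_iota.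
have Huv : perm_eq (u ++ v) (iota 1 n) by rewrite -est perm_sym perm_straighten.
rewrite -(cnt_pred1 Huv); apply: eq_cnt => w Hw /=.
rewrite split_mono_straighten; apply/idP/eqP => [H|->]; last first.
  by rewrite take_size_cat // drop_size_cat // est -sorted_pairwise ?iota_ltn_sorted //; apply: ltn_trans.
have Hp : perm_eq (straighten b1 b2 b3 (take i w) (drop i w)) (iota 1 n).
  by apply: perm_trans (perm_straighten _ _ _ _ _) _; rewrite cat_take_drop.
have E : straighten b1 b2 b3 (take i w) (drop i w) = straighten b1 b2 b3 u v.
  rewrite est; apply: (irr_sorted_eq ltn_trans ltnn _ (iota_ltn_sorted _ _) (perm_mem Hp)).
  by rewrite sorted_pairwise //; apply: ltn_trans.
have sw := perm_size_iota Hw.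
have st : size (take i w) = size u by rewrite size_takel ?sw.
have sd : size (drop i w) = size v by rewrite size_drop sw /v /t; case: (b2); case: (b3); rewrite ?size_rev size_iota.
suff [<- <-] : take i w = u /\ drop i w = v by rewrite cat_take_drop.
have Hr b (x y : seq nat) : (if b then x else rev x) = (if b then y else rev y) -> x = y.
  by case: b => // /(can_inj revK).
have Hs b (x y : seq nat) : size x = size y -> 
  size (if b then x else rev x) = size (if b then y else rev y).
  by case: b; rewrite ?size_rev.
(* Equal concatenations with blocks of equal sizes agree block by block, and each possible reversal
   is injective. *)
by move/eqP: E; rewrite /straighten; case: (b3); rewrite eqseq_cat; try (exact: Hs);
  case/andP=> /eqP /Hr -> /eqP /Hr ->.
Qed.

(** * Reverse-complement and effect of the maximum on avoidance *)

(* Reverse-complement of a word with letters in 1..n. *)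
Definition rc n (w : seq nat) := rev [seq n.+1 - x | x <- w].

Lemma zip_map2 (f g : nat -> nat) a b :
  zip (map f a) (map g b) = [seq (f p.1, g p.2) | p <- zip a b].
Proof. by elim: a b => [|x a IH] [|y b] //=; rewrite IH. Qed.

Lemma pairwise_rev (T : Type) (r : rel T) s :
  pairwise r (rev s) = pairwise (fun x y => r y x) s.
Proof. by elim: s => //= x s IH; rewrite rev_cons pairwise_rcons all_rev IH. Qed.

(** Reversal exchanges the two positions of a pair and complement exchanges their order, so each
    comparison survives; the bounds keep truncated subtraction strictly decreasing. *)
Lemma oiso_rc n k a b : all (leq^~ n) a -> all (leq^~ k) b ->
  oiso (rc n a) (rc k b) = oiso a b.
Proof.
move=> Ha Hb; rewrite /oiso /rc !size_rev !size_map; case: eqP => //= sab.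
rewrite -rev_zip ?size_map // pairwise_rev zip_map2 pairwise_map.
apply: (@eq_in_pairwise _ [pred p | (p.1 <= n) && (p.2 <= k)]); last first.
  by elim: a b Ha Hb sab => [|x a IH] [|y b] //= /andP[-> Ha] /andP[-> Hb] [] /(IH _ Ha Hb).
move=> [x y] [x' y']; rewrite !inE /agree /=; lia.
Qed.

Lemma rcK n w : all (leq^~ n) w -> rc n (rc n w) = w.
Proof.
move=> H; rewrite /rc map_rev revK -map_comp map_id_in // => x /(allP H) /=; lia.
Qed.

Lemma contains_rc n k w p : all (leq^~ n) w -> all (leq^~ k) p ->
  contains w p -> contains (rc n w) (rc k p).
Proof.
move=> Hw Hp /containsP[a aw ap]; apply/containsP; exists (rc n a).
  by rewrite subseq_rev map_subseq.
rewrite oiso_rc //; apply/allP => x /(mem_subseq aw); exact: (allP Hw).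
Qed.

Lemma perm_rc n w : perm_eq w (iota 1 n) -> perm_eq (rc n w) (iota 1 n).
Proof.
move=> Hw; rewrite /rc perm_rev; apply: uniq_perm.
- rewrite map_inj_in_uniq ?(perm_uniq Hw) ?iota_uniq // => x y.
  rewrite !(perm_mem Hw) !mem_iota; lia.
- exact: iota_uniq.
move=> x; rewrite mem_iota; apply/mapP/idP => [[y]|xn].
  rewrite (perm_mem Hw) mem_iota; lia.
by exists (n.+1 - x); rewrite ?(perm_mem Hw) ?mem_iota; lia.
Qed.

Lemma perm_le n w : perm_eq w (iota 1 n) -> all (leq^~ n) w.
Proof. by move=> Hw; apply/allP => x; rewrite (perm_mem Hw) mem_iota /=; lia. Qed.

Lemma cnt_rc n P : cnt n P = cnt n (fun w => P (rc n w)).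
Proof.
rewrite /cnt -(count_map (rc n) P); apply/seq.permP.
have H : {subset map (rc n) (permutations (iota 1 n)) <= permutations (iota 1 n)}.
  by move=> w /mapP[v]; rewrite !mem_permutations => /perm_rc Hv ->.
have U : uniq (map (rc n) (permutations (iota 1 n))).
  rewrite map_inj_in_uniq ?permutations_uniq // => v w.
  rewrite !mem_permutations => /perm_le Hv /perm_le Hw E.
  by rewrite -(rcK Hv) E rcK.
rewrite perm_sym; apply: uniq_perm => //; first exact: permutations_uniq.
by apply: (uniq_min_size U H _).2; rewrite size_map.
Qed.

Definition cav n ps := cnt n (fun w => all (avoids w) ps).

(** Containment is preserved by [rc] and [rc] is an involution, so it is also reflected. Positivity
    of the pattern letters keeps [rc (size p) p] within 1..[size p]. *)
Lemma cav_rc n ps : all (fun p => all (fun x => 0 < x <= size p) p) ps ->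
  cav n ps = cav n [seq rc (size p) p | p <- ps].
Proof.
move=> Hps; rewrite /cav cnt_rc; apply: eq_cnt => w /[dup] /perm_rc /perm_le Hrw /perm_le Hw.
rewrite all_map; apply: eq_in_all => p pps /=; have /allP H := allP Hps p pps.
have Hp : all (leq^~ (size p)) p by apply/allP => x /H /andP[].
have Hrp : all (leq^~ (size p)) (rc (size p) p).
  by apply/allP => x; rewrite mem_rev => /mapP[y yp ->]; have /andP[] := H y yp; lia.
congr negb; apply/idP/idP => [/(contains_rc Hrw Hp)|/(contains_rc Hw Hrp)]; by rewrite rcK.
Qed.

Lemma occ2_contains u v p1 p2 : occ2 u v p1 p2 -> contains (u ++ v) (p1 ++ p2).
Proof.
case=> a [b [au bv _ H]]; apply/containsP; exists (a ++ b) => //; exact: cat_subseq.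
Qed.

Lemma occ2_right u v p1 p2 : occ2 u v p1 p2 -> contains v p2.
Proof.
case=> a [b [_ bv sz /(oiso_cat sz) [_ H _]]]; by apply/containsP; exists b.
Qed.

(** A letter of [u] lying below (or above) all of [v] can play a first pattern letter with the same
    relation to [p], so any occurrence of [p] in [v] extends. *)
Lemma occ2_head b x u v y p : x \in u -> all (rel_of b x) v -> all (rel_of b y) p ->
  contains v p -> occ2 u v [:: y] p.
Proof.
move=> xu Hv Hp /containsP[a av ap]; exists [:: x], a; rewrite sub1seq.
split=> //=; rewrite oiso_cons ap andbT.
have Ha : all (rel_of b x) a by apply/allP => z /(mem_subseq av) /(allP Hv).
elim: a p Ha Hp {av ap} => [|z a IH] [|t p] //= /andP[xz Ha] /andP[yt Hp].
rewrite (IH _ Ha Hp) andbT; move: xz yt; rewrite /rel_of /agree; case: (b) => /=; lia.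
Qed.

Lemma occ2_last b x u v y p : x \in v -> all (rel_of b ^~ x) u -> all (rel_of b ^~ y) p ->
  contains u p -> occ2 u v p [:: y].
Proof.
move=> xv Hu Hp /containsP[a au ap]; exists a, [:: x]; rewrite sub1seq.
have sz := oiso_size ap.
split=> //=; rewrite /oiso !size_cat /= sz eqxx zip_cat //= pairwise_cat allrel1r.
case/andP: ap => _ ->; rewrite /= !andbT.
have Ha : all (rel_of b ^~ x) a by apply/allP => z /(mem_subseq au) /(allP Hu).
elim: a p Ha Hp {au sz} => [|z a IH] [|t p] //= /andP[xz Ha] /andP[yt Hp].
rewrite (IH _ Ha Hp) andbT; move: xz yt; rewrite /rel_of /agree; case: (b) => /=; lia.
Qed.

(** Distinct letters matter here: two equal letters avoid 12 without being strictly decreasing. For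
    21 below, [agree] already counts an equal pair as an occurrence. *)
Lemma avoids_dec w : uniq w -> avoids w [:: 1; 2] = pairwise (rel_of false) w.
Proof.
move=> uw; apply/idP/idP; last first.
  (* With an empty first block the shape holds for any first and third flags; these values make
     every cut of 12 fail the check. *)
  move=> H; rewrite -[w]cat0s; apply: (@split_mono_avoids false false false) => //.
  by rewrite /split_mono H.
elim: w uw => //= x w IH /andP[xw uw] H; apply/andP; split; last first.
  apply: IH => //; apply: contra H => /containsP[a aw Ha]; apply/containsP; exists a => //.
  exact: subseq_trans aw (subseq_cons _ _).
apply/allP => y yw; rewrite /rel_of /=; case: (ltngtP x y) => // [xy|exy]; last by rewrite exy yw in xw.
case/negP: H; apply/containsP; exists [:: x; y]; first by rewrite /= eqxx sub1seq.
by rewrite /oiso /= /agree /= xy.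
Qed.

Lemma avoids_inc w : avoids w [:: 2; 1] = pairwise (rel_of true) w.
Proof.
apply/idP/idP; last first.
  move=> H; rewrite -[w]cat0s; apply: (@split_mono_avoids true true true) => //.
  by rewrite /split_mono H.
elim: w => //= x w IH H; apply/andP; split; last first.
  apply: IH => //; apply: contra H => /containsP[a aw Ha]; apply/containsP; exists a => //.
  exact: subseq_trans aw (subseq_cons _ _).
apply/allP => y yw; rewrite /rel_of /=; case: ltnP => // xy.
case/negP: H; apply/containsP; exists [:: x; y]; first by rewrite /= eqxx sub1seq.
by rewrite /oiso /= /agree /= ltnNge xy.
Qed.

Section InsertMax.
Variables (m : nat) (u v : seq nat).
Hypotheses (Hu : uniq (u ++ v)) (Hm : all (ltn^~ m) (u ++ v)).

Lemma avoids_insP p1 q p2 : all (ltn^~ q) (p1 ++ p2) ->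
  avoids (u ++ m :: v) (p1 ++ q :: p2) <-> avoids (u ++ v) (p1 ++ q :: p2) /\ ~ occ2 u v p1 p2.
Proof.
move=> Hq; have H := containsP_insmax Hm Hq; rewrite /avoids; split.
  by move=> /negP h; split; [apply/negP|] => h'; apply/h/H; [left|right].
by case=> /negP h1 h2; apply/negP => /H [].
Qed.

Lemma avoids_ins_end p q : all (ltn^~ q) p ->
  avoids (u ++ m :: v) (p ++ [:: q]) = avoids (u ++ v) (p ++ [:: q]) && avoids u p.
Proof.
move=> Hq; apply/idP/andP; rewrite -/(is_true _) avoids_insP ?cats0 // => -[-> h]; split => //.
  by apply/negP => h'; apply/h/occ2_nilr.
by move/occ2_nilr; apply/negP.
Qed.

Lemma avoids_ins_begin p q : all (ltn^~ q) p ->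
  avoids (u ++ m :: v) (q :: p) = avoids (u ++ v) (q :: p) && avoids v p.
Proof.
move=> Hq; apply/idP/andP; rewrite -/(is_true _) -[q :: p]cat0s avoids_insP // => -[-> h]; split => //.
  by apply/negP => h'; apply/h/occ2_nill.
by move/occ2_nill; apply/negP.
Qed.

(** The occurrences using [m] are pairs across the bar ordered like [x], [y]. Forbidding them leaves
    the opposite order for all pairs, strict because the letters are distinct. *)
Lemma avoids_ins_middle x q y : x != y -> x < q -> y < q ->
  avoids (u ++ m :: v) [:: x; q; y] =
  avoids (u ++ v) [:: x; q; y] && allrel (rel_of (y < x)) u v.
Proof.
move=> xy xq yq; apply/idP/andP; rewrite -/(is_true _) -[[:: x; q; y]]/([:: x] ++ q :: [:: y]) avoids_insP /= ?xq ?yq // => -[-> h]; split => //.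
  apply/allrelP => a b au bv; have := Hu; rewrite cat_uniq => /and3P[_ /hasPn /(_ b bv) /=  nb _].
  have ab : a != b by apply: contraNneq nb => <-.
  have : ~ ((a < b) = (x < y)) by move=> e; apply/h/occ2_11; exists a, b.
  move: xy ab; rewrite /rel_of; case: (ltngtP x y) => //=; lia.
move/occ2_11 => [a [b [au bv]]]; have /allrelP /(_ a b au bv) := h.
move: xy; rewrite /rel_of; case: (ltngtP x y) => //=; lia.
Qed.

Lemma uniq_l : uniq u. Proof. by have := Hu; rewrite cat_uniq => /and3P[]. Qed.

Lemma avoids_ins123 : avoids (u ++ m :: v) [:: 1; 2; 3] =
  avoids (u ++ v) [:: 1; 2; 3] && pairwise (rel_of false) u.
Proof. by rewrite (@avoids_ins_end [:: 1; 2] 3) // avoids_dec ?uniq_l. Qed.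

Lemma avoids_ins213 : avoids (u ++ m :: v) [:: 2; 1; 3] =
  avoids (u ++ v) [:: 2; 1; 3] && pairwise (rel_of true) u.
Proof. by rewrite (@avoids_ins_end [:: 2; 1] 3) // avoids_inc. Qed.

Lemma avoids_ins132 : avoids (u ++ m :: v) [:: 1; 3; 2] =
  avoids (u ++ v) [:: 1; 3; 2] && allrel (rel_of false) u v.
Proof. exact: avoids_ins_middle. Qed.

Lemma avoids_ins231 : avoids (u ++ m :: v) [:: 2; 3; 1] =
  avoids (u ++ v) [:: 2; 3; 1] && allrel (rel_of true) u v.
Proof. exact: avoids_ins_middle. Qed.

End InsertMax.

(** * Recurrences and the classes avoiding 132 and 231 *)

Lemma cnt_sum n (P : pred (seq nat)) : cnt n P = \sum_(w <- permutations (iota 1 n)) P w.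
Proof. by rewrite /cnt -sum1_count big_mkcond; apply: eq_bigr => w _; case: (P w). Qed.

Lemma avoids_short w p : size w < size p -> avoids w p.
Proof.
by move=> wp; apply/negP => /containsP[a /size_subseq aw /oiso_size sz]; rewrite -sz ltnNge aw in wp.
Qed.

Lemma cav_small n ps : n <= 1 -> all (fun p => n < size p) ps -> cav n ps = 1.
Proof.
move=> n1 /allP Hps; rewrite /cav (@eq_cnt _ _ predT).
  by rewrite /cnt count_predT size_permutations ?iota_uniq // size_iota; case: n n1 {Hps} => [|[]].
by move=> w /perm_size_iota sw; apply/allP => p /Hps; rewrite -sw; apply: avoids_short.
Qed.

Lemma ins_ok n i w : perm_eq w (iota 1 n) ->
  uniq (take i w ++ drop i w) /\ all (ltn^~ n.+1) (take i w ++ drop i w).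
Proof.
move=> Hw; rewrite cat_take_drop (perm_uniq Hw) iota_uniq; split=> //.
exact: perm_le Hw.
Qed.

(** The first place reproduces the class one size down; each of the other n places leaves a single
    split word. *)
Lemma cav_first ps b1 b2 b3 :
  (forall u v m, uniq (u ++ v) -> all (ltn^~ m) (u ++ v) ->
     all (avoids (u ++ m :: v)) ps =
     if u is [::] then all (avoids v) ps else split_mono b1 b2 b3 u v) ->
  forall n, cav n.+1 ps = cav n ps + n.
Proof.
move=> H n; rewrite /cav cnt_insert big_ord_recl; congr addn.
  by apply: eq_cnt => w /(@ins_ok _ 0) [h1 h2]; rewrite /ins H // take0 drop0.
rewrite -[RHS]muln1 -[n in RHS]card_ord -sum_nat_const; apply: eq_bigr => i _.
rewrite -(@cnt_split_mono b1 b2 b3 n i.+1) //; apply: eq_cnt => w Hw.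
have [h1 h2] := ins_ok i.+1 Hw; rewrite /ins lift0 H //.
(* A nonempty [w] has a nonempty prefix of length [i.+1], so the split branch applies; an empty one
   forces n = 0, where no index [i] exists. *)
by case: w Hw {h1 h2} => [/perm_size_iota /= n0|//]; case: i => i; rewrite -n0.
Qed.

Lemma cav_last ps b1 b2 b3 :
  (forall u v m, uniq (u ++ v) -> all (ltn^~ m) (u ++ v) ->
     all (avoids (u ++ m :: v)) ps =
     if v is [::] then all (avoids u) ps else split_mono b1 b2 b3 u v) ->
  forall n, cav n.+1 ps = cav n ps + n.
Proof.
move=> H n; rewrite /cav cnt_insert big_ord_recr [LHS]addnC; congr addn.
  apply: eq_cnt => w Hw; have [h1 h2] := ins_ok n Hw.
  by rewrite /ins /= H // take_oversize ?drop_oversize // (perm_size_iota Hw).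
rewrite -[RHS]muln1 -[n in RHS]card_ord -sum_nat_const; apply: eq_bigr => i _.
rewrite -(@cnt_split_mono b1 b2 b3 n i) 1?ltnW //; apply: eq_cnt => w Hw.
have [h1 h2] := ins_ok i Hw; rewrite /ins H //.
case E: (drop i w) => //; exfalso; move: (size_drop i w); rewrite E (perm_size_iota Hw) /=.
by have := ltn_ord i; lia.
Qed.

Lemma quadratic_rec f : f 0 = 1 -> (forall n, f n.+1 = f n + n) -> forall n, f n = 'C(n, 2) + 1.
Proof. by move=> f0 fS; elim=> // n IH; rewrite fS IH binS bin1; lia. Qed.

(** The start is at 1 because the added term is the size of an auxiliary class, which equals its
    index only from 1 on: the empty word still counts as one. *)
Lemma quadratic_rec1 f : f 1 = 1 -> (forall n, f n.+2 = n.+1 + f n.+1) ->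
  forall n, 0 < n -> f n = 'C(n, 2) + 1.
Proof. by move=> f1 fS [|n] // _; elim: n => // n IH; rewrite fS IH [in RHS]binS bin1; lia. Qed.

Lemma linear_rec f : f 1 = 1 -> (forall n, f n.+2 = f n.+1 + 1) -> forall n, f n.+1 = n.+1.
Proof. by move=> f1 fS; elim=> // n IH; rewrite fS IH addn1. Qed.

Lemma cav_strongest n p ps : p \in ps -> all (contains^~ p) ps ->
  cav n ps = cav n [:: p].
Proof.
move=> pps /allP H; apply: eq_cnt => w _ /=; rewrite andbT.
apply/allP/idP => [/(_ p pps)//|Hp q /H qp]; exact: avoids_mono qp Hp.
Qed.

Lemma cav12 n : cav n [:: [:: 1; 2]] = 1.
Proof.
rewrite -[RHS](@cnt_split_mono false false false n 0) //; apply: eq_cnt => w Hw.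
by rewrite /= andbT avoids_dec ?(perm_uniq Hw) ?iota_uniq // take0 drop0 /split_mono /= andbT.
Qed.

Lemma cav21 n : cav n [:: [:: 2; 1]] = 1.
Proof.
rewrite -[RHS](@cnt_split_mono false true false n 0) //; apply: eq_cnt => w Hw.
by rewrite /= andbT avoids_inc take0 drop0 /split_mono /= andbT.
Qed.

Lemma avoids_absorb w p q : contains p q -> avoids w p && avoids w q = avoids w q.
Proof.
by move=> pq; case: (boolP (avoids w q)) => [/(avoids_mono pq) ->|]; rewrite ?andbF.
Qed.

Lemma contains_refl p : contains p p.
Proof.
apply/containsP; exists p; rewrite ?subseq_refl // /oiso eqxx /=.
by elim: p => //= x p ->; rewrite andbT; elim: p => //= y p ->; rewrite /agree eqxx.
Qed.

Lemma subseq_contains p q : subseq q p -> contains p q.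
Proof.
move=> qp; have /containsP[a aq ao] := contains_refl q.
by apply/containsP; exists a => //; apply: subseq_trans qp.
Qed.

Lemma cav_132_231 n tau taul taur :
  (forall v m, uniq v -> all (ltn^~ m) v -> avoids (m :: v) tau = avoids v tau && avoids v taul) ->
  (forall u m, uniq u -> all (ltn^~ m) u -> avoids (rcons u m) tau = avoids u tau && avoids u taur) ->
  contains tau taul -> contains tau taur ->
  cav n.+2 [:: [:: 1; 3; 2]; [:: 2; 3; 1]; tau] =
  cav n.+1 [:: [:: 1; 3; 2]; [:: 2; 3; 1]; taul] + cav n.+1 [:: [:: 1; 3; 2]; [:: 2; 3; 1]; taur].
Proof.
move=> Hl Hr Tl Tr; rewrite /cav cnt_insert big_ord_recl big_ord_recr /= addnCA big1 ?add0n; last first.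
  move=> i _; rewrite -[RHS](cnt_pred0 n.+1); apply: eq_cnt => w Hw.
  have [h1 h2] := ins_ok i.+1 Hw.
  rewrite -[bump 0 i]/(i.+1) /ins avoids_ins132 // avoids_ins231 //; apply/negbTE/negP.
  case/and3P=> /andP[_ h3] /andP[_ h4] _; move: h3 h4.
  have sw := perm_size_iota Hw.
  case E: (take _ w) => [|x u]; first by move: (congr1 size E); rewrite size_takel // sw ltnS ltnW.
  case E': (drop _ w) => [|y v]; first by move: (congr1 size E'); rewrite size_drop sw /=; have := ltn_ord i; lia.
  by rewrite /= => /andP[/andP[yx _] _] /andP[/andP[xy _] _]; have := ltn_trans xy yx; rewrite ltnn.
congr addn; apply: eq_cnt => w Hw; have sw := perm_size_iota Hw.
  have [h1 h2] := ins_ok 0 Hw; rewrite take0 drop0 in h1 h2.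
  have := @avoids_ins132 n.+2 [::] w h1 h2; have := @avoids_ins231 n.+2 [::] w h1 h2.
  rewrite /ins take0 drop0 => -> ->; rewrite Hl // !andbT.
  by rewrite avoids_absorb.
have [h1 h2] := ins_ok n.+1 Hw.
have := @avoids_ins132 n.+2 _ _ h1 h2; have := @avoids_ins231 n.+2 _ _ h1 h2.
rewrite -[bump 0 n]/(n.+1) /ins take_oversize ?drop_oversize ?sw // !cats0 => -> ->.
rewrite take_oversize ?drop_oversize ?sw // cats0 in h1 h2.
by rewrite !allrel0r !andbT cats1 Hr // avoids_absorb.
Qed.

(** A leading maximum cannot take part in a pattern that ends with its own maximum, so only a
    trailing one shortens the pattern. *)
Lemma cav_132_231_end n t q : all (ltn^~ q) t -> 0 < size t ->
  cav n.+2 [:: [:: 1; 3; 2]; [:: 2; 3; 1]; t ++ [:: q]] =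
  cav n.+1 [:: [:: 1; 3; 2]; [:: 2; 3; 1]; t ++ [:: q]] + cav n.+1 [:: [:: 1; 3; 2]; [:: 2; 3; 1]; t].
Proof.
move=> Hq t0; apply: cav_132_231; rewrite ?contains_refl ?subseq_contains ?prefix_subseq //.
- move=> v m Hu Hm; have := @avoids_ins_end m [::] v Hm t q Hq => /= ->.
  by rewrite [avoids [::] t]avoids_short // andbT andbb.
- move=> u m Hu Hm; rewrite -cats1; have := @avoids_ins_end m u [::]; rewrite cats0; exact.
Qed.

Lemma cav_132_231_begin n t q : all (ltn^~ q) t -> 0 < size t ->
  cav n.+2 [:: [:: 1; 3; 2]; [:: 2; 3; 1]; q :: t] =
  cav n.+1 [:: [:: 1; 3; 2]; [:: 2; 3; 1]; t] + cav n.+1 [:: [:: 1; 3; 2]; [:: 2; 3; 1]; q :: t].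
Proof.
move=> Hq t0; apply: cav_132_231; rewrite ?contains_refl ?subseq_contains ?subseq_cons //.
- move=> v m Hu Hm; exact: (@avoids_ins_begin m [::] v Hm).
- move=> u m Hu Hm; rewrite -cats1 (@avoids_ins_begin m u [::]) ?cats0 //.
  by rewrite [avoids [::] t]avoids_short // andbT andbb.
Qed.

Lemma cav_132_231_12 n : cav n [:: [:: 1; 3; 2]; [:: 2; 3; 1]; [:: 1; 2]] = 1.
Proof. by rewrite (@cav_strongest _ [:: 1; 2]) ?cav12 //= !containsE. Qed.

Lemma cav_132_231_21 n : cav n [:: [:: 1; 3; 2]; [:: 2; 3; 1]; [:: 2; 1]] = 1.
Proof. by rewrite (@cav_strongest _ [:: 2; 1]) ?cav21 //= !containsE. Qed.

Lemma cav_132_231_S3 n t : t \in [:: [:: 1; 2; 3]; [:: 2; 1; 3]; [:: 3; 1; 2]; [:: 3; 2; 1]] ->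
  cav n.+1 [:: [:: 1; 3; 2]; [:: 2; 3; 1]; t] = n.+1.
Proof.
rewrite !inE => /or4P[] /eqP ->;
  apply: (linear_rec (f := fun n => cav n [:: _; _; _])) => [|{}n]; try by apply: cav_small.
- by rewrite (@cav_132_231_end _ [:: 1; 2] 3) // cav_132_231_12.
- by rewrite (@cav_132_231_end _ [:: 2; 1] 3) // cav_132_231_21.
- by rewrite (@cav_132_231_begin _ [:: 1; 2] 3) // cav_132_231_12 addnC.
- by rewrite (@cav_132_231_begin _ [:: 2; 1] 3) // cav_132_231_21 addnC.
Qed.

Lemma cav_132_231_S4 n t : 0 < n -> t \in [:: [:: 1; 2; 3]; [:: 2; 1; 3]; [:: 3; 1; 2]; [:: 3; 2; 1]] ->
  cav n [:: [:: 1; 3; 2]; [:: 2; 3; 1]; t ++ [:: 4]] = 'C(n, 2) + 1.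
Proof.
move=> n0 Ht; have [H s] : all (ltn^~ 4) t /\ size t = 3.
  by move: Ht; rewrite !inE => /or4P[] /eqP ->.
apply: (quadratic_rec1 (f := fun n => cav n [:: _; _; _])) => // [|{n0}n].
  by apply: cav_small; rewrite //= size_cat s.
by rewrite cav_132_231_end ?s // (cav_132_231_S3 _ Ht) addnC.
Qed.

Lemma cav_132_231_4123 n : 0 < n ->
  cav n [:: [:: 1; 3; 2]; [:: 2; 3; 1]; [:: 4; 1; 2; 3]] = 'C(n, 2) + 1.
Proof.
move=> n0.
apply: (quadratic_rec1 (f := fun n => cav n [:: _; _; _])) => // [|{n0}n]; first exact: cav_small.
by rewrite (@cav_132_231_begin _ [:: 1; 2; 3] 4) // cav_132_231_S3.
Qed.

(** * The other classes *)

Lemma uniq_r (u v : seq nat) : uniq (u ++ v) -> uniq v.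
Proof. by rewrite cat_uniq => /and3P[]. Qed.

(** 231 puts [u] below [v] and 123 makes [u] decreasing. Once [u] has a letter, an ascent in [v]
    would complete a 123, so [v] decreases too. *)
Lemma cav_123_231 n : cav n [:: [:: 1; 2; 3]; [:: 2; 3; 1]] = 'C(n, 2) + 1.
Proof.
apply: (quadratic_rec (f := fun n => cav n _)) => {n}; first exact: cav_small.
apply: (@cav_first _ false false true) => u v m Hu Hm.
rewrite /= avoids_ins123 // avoids_ins231 //.
case: u Hu Hm => [|x u] Hu Hm; first by rewrite !andbT.
rewrite andbT; apply/andP/idP => [[/andP[av ud] /andP[_ uv]]|S].
  rewrite /split_mono ud uv andbT -avoids_dec ?(uniq_r Hu) //.
  apply: contra av => H; apply: (@occ2_contains _ _ [:: 1] [:: 2; 3]).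
  apply: (@occ2_head true x); rewrite ?inE ?eqxx //; first by case/andP: uv.
  by apply: contains_trans H _; rewrite containsE.
have /and3P[h1 h2 h3] := S; rewrite h1 h3 !andbT.
by split; apply: split_mono_avoids S _.
Qed.

Lemma occ2_3412_dec x u v : x \in u -> allrel (rel_of false) u v -> uniq v ->
  ~ occ2 u v [:: 3] [:: 1; 2] <-> pairwise (rel_of false) v.
Proof.
move=> xu /allrelP uv uniqv; rewrite -avoids_dec //; split=> [h|/negP h /occ2_right //].
apply/negP => H; apply: h; apply: (@occ2_head false x) => //.
by apply/allP => y; apply: uv.
Qed.

(** An occurrence through [m] takes its 3 from [u] and its 12 from [v]. With [u] above [v], any
    letter of [u] serves as the 3, so the condition is that [u] is empty or [v] has no ascent. *)
Lemma avoids_ins3412 m u v : uniq (u ++ v) -> all (ltn^~ m) (u ++ v) ->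
  allrel (rel_of false) u v ->
  avoids (u ++ m :: v) [:: 3; 4; 1; 2] =
  avoids (u ++ v) [:: 3; 4; 1; 2] && (nilp u || pairwise (rel_of false) v).
Proof.
move=> Hu Hm uv; have H := @avoids_insP m u v Hm [:: 3] 4 [:: 1; 2] isT.
case: u uv Hu Hm H => [|x u] uv Hu Hm H.
  rewrite andbT; apply/idP/idP => [/H []|av] //; apply/H; split=> // -[a [b [/eqP ->]]].
  by rewrite /=.
have D := @occ2_3412_dec x (x :: u) v (mem_head _ _) uv (uniq_r Hu).
by apply/idP/andP => [/H [-> /D ->]|[av /D oc]] //; apply/H.
Qed.

Lemma cav_123_132_3412 n : cav n [:: [:: 1; 2; 3]; [:: 1; 3; 2]; [:: 3; 4; 1; 2]] = 'C(n, 2) + 1.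
Proof.
apply: (quadratic_rec (f := fun n => cav n _)) => {n}; first exact: cav_small.
apply: (@cav_first _ false false false) => u v m Hu Hm.
rewrite /= avoids_ins123 // avoids_ins132 //.
case uv: (allrel (rel_of false) u v); last first.
  case: u uv {Hu Hm} => [|x u] // uv.
  by rewrite /split_mono uv !andbF.
rewrite avoids_ins3412 //; case: u uv Hu Hm => [|x u] uv Hu Hm; first by rewrite !andbT.
rewrite /= !andbT; apply/idP/idP => [/and3P[/andP[_ h1] _ /andP[_ h2]]|S].
  by rewrite /split_mono uv h2 /= h1.
have /and3P[/= h1 h2 _] := S; rewrite h1 h2 !andbT.
by apply/and3P; split; apply: split_mono_avoids S _.
Qed.

Lemma cav_132_213_3412 n : cav n [:: [:: 1; 3; 2]; [:: 2; 1; 3]; [:: 3; 4; 1; 2]] = 'C(n, 2) + 1.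
Proof.
apply: (quadratic_rec (f := fun n => cav n _)) => {n}; first exact: cav_small.
apply: (@cav_first _ true false false) => u v m Hu Hm.
rewrite /= avoids_ins132 // avoids_ins213 //.
case uv: (allrel (rel_of false) u v); last first.
  case: u uv {Hu Hm} => [|x u] // uv.
  by rewrite /split_mono uv !andbF.
rewrite avoids_ins3412 //; case: u uv Hu Hm => [|x u] uv Hu Hm; first by rewrite !andbT.
rewrite /= !andbT; apply/idP/idP => [/and3P[_ /andP[_ h1] /andP[_ h2]]|S].
  by rewrite /split_mono uv h2 /= h1.
have /and3P[/= h1 h2 _] := S; rewrite h1 h2 !andbT.
by apply/and3P; split; apply: split_mono_avoids S _.
Qed.

(** 132 puts [u] above [v] and 321 makes [v] increasing. If [v] has a letter, it lies below all of
    [u], so a descent in [u] would complete a 321; hence [u] increases. *)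
Lemma cav_132_321 n : cav n [:: [:: 1; 3; 2]; [:: 3; 2; 1]] = 'C(n, 2) + 1.
Proof.
apply: (quadratic_rec (f := fun n => cav n _)) => {n}; first exact: cav_small.
apply: (@cav_last _ true true false) => u v m Hu Hm.
rewrite /= avoids_ins132 // (@avoids_ins_begin m u v Hm [:: 2; 1] 3) // avoids_inc.
case: v Hu Hm => [|y v] Hu Hm; first by rewrite cats0 allrel0r !andbT.
rewrite andbT; apply/andP/idP => [[/andP[_ uv] /andP[av vd]]|S].
  rewrite /split_mono vd uv !andbT -avoids_inc.
  apply: contra av => H; apply: (@occ2_contains _ _ [:: 3; 2] [:: 1]).
  apply: (@occ2_last false y); rewrite ?inE ?eqxx //.
    by apply/allP => x xu; have /allrelP /(_ x y xu (mem_head _ _)) := uv.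
  by apply: contains_trans H _; rewrite containsE.
have /and3P[h1 h2 h3] := S; rewrite h2 h3 !andbT.
by split; apply: split_mono_avoids S _.
Qed.

(** * Classes avoiding 132 and 213 *)

Lemma avoids_ins_132_213 u v m q t : uniq (u ++ v) -> all (ltn^~ m) (u ++ v) -> all (ltn^~ q) t ->
  all (avoids (u ++ m :: v)) [:: [:: 1; 3; 2]; [:: 2; 1; 3]; q :: t] =
  [&& all (avoids (u ++ v)) [:: [:: 1; 3; 2]; [:: 2; 1; 3]; q :: t],
      allrel (rel_of false) u v, pairwise (rel_of true) u & avoids v t].
Proof.
move=> Hu Hm Hq; rewrite /= avoids_ins132 // avoids_ins213 // (@avoids_ins_begin m u v Hm t q) //.
by do 3 case: (avoids (u ++ v) _) => //=; rewrite ?andbF //= !andbT.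
Qed.

(* Only the place just after n+1 can receive n+2 once some letter precedes it, and
   inserting it there preserves the class. *)
Lemma cav_132_213_shift n q t i : all (ltn^~ q) t -> i < n.+1 ->
  forall w, perm_eq w (iota 1 n.+1) ->
  all (avoids (ins i.+1 n.+2 w)) [:: [:: 1; 3; 2]; [:: 2; 1; 3]; q :: t] =
  (nth 0 w i == n.+1) && all (avoids w) [:: [:: 1; 3; 2]; [:: 2; 1; 3]; q :: t].
Proof.
move=> Hq iN w Hw; have sw := perm_size_iota Hw.
have [] := ins_ok i.+1 Hw; rewrite /ins (take_nth 0) ?sw //.
set u := take i w; set v := drop i.+1 w; set x := nth 0 w i => Hu Hm.
have Ew : w = u ++ x :: v by rewrite -drop_nth ?sw // cat_take_drop.
have w_max : n.+1 \in w by rewrite (perm_mem Hw) mem_iota; lia.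
have w_le y : y \in w -> y <= n.+1 by rewrite (perm_mem Hw) mem_iota; lia.
have x_w : x \in w by rewrite mem_nth ?sw.
rewrite avoids_ins_132_213 // cat_rcons -Ew pairwise_rcons -cats1 allrel_catl allrel1l.
case: eqP => [xn|xn]; last first.
  (* If [x] is not the old maximum, that maximum lies in [u], whose letters must be below [x], or in
     [v], which must also lie below [x]. *)
  apply/negbTE/negP => /and4P[_ /andP[_ /allP xv] /andP[/allP ux _] _].
  move: w_max; rewrite Ew mem_cat inE => /or3P[/ux|/eqP nx|/xv]; rewrite /rel_of /=.
  - by rewrite ltnNge w_le.
  - exact: xn.
  - by rewrite ltnNge w_le.
have Hu' : uniq (u ++ v) by move: Hu; rewrite cat_rcons uniq_catC /= => /andP[_]; rewrite uniq_catC.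
have Hm' : all (ltn^~ n.+1) (u ++ v).
  apply/allP => y yuv; rewrite /= ltn_neqAle -xn; apply/andP; split.
    apply: contraTneq yuv => ->; move: Hu; rewrite cat_rcons uniq_catC /= => /andP[+ _].
    by rewrite !mem_cat orbC.
  by rewrite xn w_le // Ew; move: yuv; rewrite !mem_cat inE => /orP[] ->; rewrite ?orbT.
(* Now [w] itself arises by inserting [n.+1] between [u] and [v], so its own avoidance already
   contains the three conditions required of the new insertion. *)
rewrite xn in Ew *; rewrite andTb Ew avoids_ins_132_213 // -andbA; congr andb.
have -> : all (rel_of false n.+1) v.
  by apply/allP => y yv; apply: (allP Hm'); rewrite mem_cat yv orbT.
have -> : all ((rel_of true)^~ n.+1) u.
  by apply/allP => y yu; apply: (allP Hm'); rewrite mem_cat yu.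
by rewrite !andbT !andTb; case: (allrel _ _ _); case: (pairwise _ _); case: (avoids _ _).
Qed.

(** A leading maximum leaves avoidance of [t], which absorbs [q :: t]. Otherwise it must follow
    [n.+1] immediately, which gives one insertion for each word of the class. *)
Lemma cav_132_213 n q t : all (ltn^~ q) t ->
  cav n.+2 [:: [:: 1; 3; 2]; [:: 2; 1; 3]; q :: t] =
  cav n.+1 [:: [:: 1; 3; 2]; [:: 2; 1; 3]; t] + cav n.+1 [:: [:: 1; 3; 2]; [:: 2; 1; 3]; q :: t].
Proof.
move=> Hq; rewrite {1}/cav cnt_insert big_ord_recl; congr addn.
  apply: eq_cnt => w Hw; have [h1 h2] := ins_ok 0 Hw.
  rewrite /ins avoids_ins_132_213 // take0 drop0 /= !andbT -!andbA avoids_absorb //.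
  by rewrite subseq_contains // subseq_cons.
rewrite (eq_bigr (fun i : 'I_n.+1 => cnt n.+1 (fun w => (nth 0 w i == n.+1) &&
    all (avoids w) [:: [:: 1; 3; 2]; [:: 2; 1; 3]; q :: t]))); last first.
  by move=> i _; apply: eq_cnt => w Hw; rewrite lift0 cav_132_213_shift.
(* Exchanging the sums fixes the word first; the inner sum over places then counts the occurrences
   of [n.+1] in it, namely one. *)
rewrite (eq_bigr _ (fun i _ => cnt_sum _ _)) exchange_big /cav cnt_sum.
rewrite !big_seq; apply: eq_bigr => w; rewrite mem_permutations => Hw.
set b := all _ _; have sw := perm_size_iota Hw.
have -> : \sum_(i < n.+1) ((nth 0 w i == n.+1) && b) = b * \sum_(i < n.+1) (nth 0 w i == n.+1).
  by rewrite big_distrr; apply: eq_bigr => i _ /=; case: b; rewrite ?andbF ?andbT ?mul1n.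
have -> : \sum_(i < n.+1) (nth 0 w i == n.+1) = count (pred1 n.+1) w.
  rewrite -sum1_count [RHS]big_mkcond [RHS](big_nth 0) sw big_mkord; apply: eq_bigr => i _ /=.
  by case: eqP.
by rewrite count_uniq_mem ?(perm_uniq Hw) ?iota_uniq // (perm_mem Hw) mem_iota /= !add1n ltnSn muln1.
Qed.

Lemma cav_132_213_4321 n : 0 < n ->
  cav n [:: [:: 1; 3; 2]; [:: 2; 1; 3]; [:: 4; 3; 2; 1]] = 'C(n, 2) + 1.
Proof.
move=> n0; apply: (quadratic_rec1 (f := fun n => cav n [:: _; _; _])) => // [|{n0}n]; first exact: cav_small.
rewrite cav_132_213 //; congr addn.
apply: (linear_rec (f := fun n => cav n [:: _; _; _])) => [|{}n]; first exact: cav_small.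
rewrite cav_132_213 // addnC; congr addn.
by rewrite (@cav_strongest _ [:: 2; 1]) ?cav21 //= !containsE.
Qed.

(** * Classes avoiding 123 and 213 *)

Lemma ins_123_213_two x y u v m tau : uniq (x :: y :: u ++ v) -> all (ltn^~ m) (x :: y :: u ++ v) ->
  all (avoids ([:: x, y & u] ++ m :: v)) [:: [:: 1; 2; 3]; [:: 2; 1; 3]; tau] = false.
Proof.
move=> Hu Hm; rewrite /= (@avoids_ins123 m [:: x, y & u] v) // (@avoids_ins213 m [:: x, y & u] v) //.
apply/negbTE/negP => /and3P[/andP[_ +] /andP[_ +] _] /=.
move=> /andP[/andP[yx _] _] /andP[/andP[xy _] _].
by move: (ltn_trans xy yx); rewrite ltnn.
Qed.

(** The letters before the maximum decrease by 123 and increase by 213, so there is at most one. [P]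
    and [Q] are the conditions left on the rest when the maximum is first or second. *)
Lemma cav_123_213 n tau (P Q : pred (seq nat)) :
  (forall w m, uniq w -> all (ltn^~ m) w ->
    all (avoids (m :: w)) [:: [:: 1; 2; 3]; [:: 2; 1; 3]; tau] = P w) ->
  (forall x w m, uniq (x :: w) -> all (ltn^~ m) (x :: w) ->
    all (avoids [:: x, m & w]) [:: [:: 1; 2; 3]; [:: 2; 1; 3]; tau] = Q (x :: w)) ->
  cav n.+2 [:: [:: 1; 2; 3]; [:: 2; 1; 3]; tau] = cnt n.+1 P + cnt n.+1 Q.
Proof.
move=> HP HQ; rewrite /cav cnt_insert !big_ord_recl [in RHS]/=.
rewrite big1 ?addn0; last first.
  move=> i _; rewrite -[RHS](cnt_pred0 n.+1); apply: eq_cnt => w Hw.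
  have [] := ins_ok i.+2 Hw; rewrite /ins !lift0; have sw := perm_size_iota Hw.
  case: w sw {Hw} => [|x [|y w]] //=; last by move=> _ Hu Hm; apply: ins_123_213_two.
  by move=> [n0]; case: i => i; rewrite -n0.
congr addn; apply: eq_cnt => w Hw.
  by have [h1 h2] := ins_ok 0 Hw; rewrite take0 drop0 in h1 h2; rewrite /ins take0 drop0; apply: HP.
have [h1 h2] := ins_ok 1 Hw; have sw := perm_size_iota Hw; rewrite lift0 /ins.
case: w sw h1 h2 {Hw} => [|x w] //=; rewrite take0 drop0 => _ h1 h2; exact: HQ.
Qed.

(** A leading maximum adds no condition. In second place, 231 puts the first letter below the rest
    and 123 makes the rest decreasing, leaving one word. *)
Lemma cav_123_213_231 n : cav n.+1 [:: [:: 1; 2; 3]; [:: 2; 1; 3]; [:: 2; 3; 1]] = n.+1.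
Proof.
apply: (linear_rec (f := fun n => cav n [:: _; _; _])) => [|{}n]; first exact: cav_small.
rewrite (@cav_123_213 _ _ (fun w => all (avoids w) [:: [:: 1; 2; 3]; [:: 2; 1; 3]; [:: 2; 3; 1]])
  (fun w => split_mono false false true (take 1 w) (drop 1 w))).
- by rewrite cnt_split_mono.
- move=> w m Hu Hm; rewrite /= (@avoids_ins123 m [::] w) // (@avoids_ins213 m [::] w) //.
  by rewrite (@avoids_ins231 m [::] w) // !andbT.
move=> x w m Hu Hm; rewrite /= take0 drop0 (@avoids_ins123 m [:: x] w) // (@avoids_ins213 m [:: x] w) //.
rewrite (@avoids_ins231 m [:: x] w) // [pairwise _ [:: x]]/= !andbT.
apply/idP/idP => [/and4P[av _ _ xw]|S].
  rewrite /split_mono xw andbT /= -avoids_dec; last by case/andP: Hu.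
  apply: contra av => H; apply: (@occ2_contains [:: x] w [:: 1] [:: 2; 3]).
  apply: (@occ2_head true x); rewrite ?inE ?eqxx //; first by rewrite allrel1l in xw.
  by apply: contains_trans H _; rewrite containsE.
(* A single letter is both increasing and decreasing. The cut check needs the increasing flag for
   213 and the decreasing one for 123. *)
have S' : split_mono true false true [:: x] w by [].
have /and3P[_ _ ->] := S; rewrite andbT.
by apply/and3P; split; [apply: split_mono_avoids S _|apply: split_mono_avoids S' _|apply: split_mono_avoids S _].
Qed.

(** Suppose [w] contains a 231 with letters [b], [c], [d]. If [x] is below [c], then [x], [b], [c]
    form 123 or 213; if above, all four letters form 4231. Hence a maximum in second place imposes
    nothing new. *)
Lemma avoids_123_213_4231 x w : uniq (x :: w) ->
  avoids (x :: w) [:: 1; 2; 3] -> avoids (x :: w) [:: 2; 1; 3] ->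
  avoids (x :: w) [:: 4; 2; 3; 1] -> avoids w [:: 2; 3; 1].
Proof.
move=> /= /andP[xw _] a1 a2 a3; apply/negP => /containsP[a aw Ha].
have := oiso_size Ha; case: a aw Ha => [|b [|c [|d []]]] //= aw Ha _.
have xa : x \notin [:: b; c; d] by apply: contra xw => /(mem_subseq aw).
have sub p : subseq p [:: b; c; d] -> subseq (x :: p) (x :: w).
  by move=> /subseq_trans /(_ aw) pw; rewrite /= eqxx.
have sbc : subseq [:: x; b; c] (x :: w).
  by apply: sub; rewrite /= !eqxx.
move: Ha xa; rewrite /oiso /= /agree /= !andbT !inE !negb_or.
case/andP=> /andP[/eqP bc /eqP bd] /eqP cd /and3P[xb xc xd].
case: (ltngtP x c) => [lxc|lcx|exc]; last by rewrite exc eqxx in xc.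
  case: (ltngtP x b) => [lxb|lbx|exb]; last by rewrite exb eqxx in xb.
    case/negP: a1; apply/containsP; exists [:: x; b; c] => //.
    by rewrite /oiso /= /agree /= lxb lxc bc.
  case/negP: a2; apply/containsP; exists [:: x; b; c] => //.
  by rewrite /oiso /= /agree /= lxc bc ltnNge (ltnW lbx).
case/negP: a3; apply/containsP; exists [:: x; b; c; d]; first exact/sub/subseq_refl.
rewrite /oiso /= /agree /= bc bd cd; lia.
Qed.

Lemma cav_123_213_4231 n : 0 < n ->
  cav n [:: [:: 1; 2; 3]; [:: 2; 1; 3]; [:: 4; 2; 3; 1]] = 'C(n, 2) + 1.
Proof.
move=> n0; apply: (quadratic_rec1 (f := fun n => cav n [:: _; _; _])) => // [|{n0}n]; first exact: cav_small.
rewrite (@cav_123_213 _ _ (fun w => all (avoids w) [:: [:: 1; 2; 3]; [:: 2; 1; 3]; [:: 2; 3; 1]])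
  (fun w => all (avoids w) [:: [:: 1; 2; 3]; [:: 2; 1; 3]; [:: 4; 2; 3; 1]])).
- by rewrite -/(cav _ _) cav_123_213_231.
- move=> w m Hu Hm; rewrite /= (@avoids_ins123 m [::] w) // (@avoids_ins213 m [::] w) //.
  rewrite (@avoids_ins_begin m [::] w Hm [:: 2; 3; 1] 4) // !andbT.
  by rewrite (@avoids_absorb w [:: 4; 2; 3; 1]) // containsE.
move=> x w m Hu Hm; rewrite /= (@avoids_ins123 m [:: x] w) // (@avoids_ins213 m [:: x] w) //.
rewrite (@avoids_ins_begin m [:: x] w Hm [:: 2; 3; 1] 4) // [pairwise _ [:: x]]/= !andbT.
apply/idP/idP => [/and4P[-> -> -> _]//|/and3P[a1 a2 a3]].
by rewrite /= [avoids _ _]a1 [avoids _ _]a2 [avoids _ _]a3 (avoids_123_213_4231 Hu a1 a2 a3).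
Qed.

(** * Collecting the cases *)

Lemma cav_absorb n p q tau : contains tau p || contains tau q ->
  cav n [:: p; q; tau] = cav n [:: p; q].
Proof.
move=> H; apply: eq_cnt => w _ /=; rewrite !andbT.
case: (boolP (avoids w p)) => //= ap; case: (boolP (avoids w q)) => //= aq.
by case/orP: H => /avoids_mono; [move/(_ _ ap)|move/(_ _ aq)].
Qed.

Lemma cav_perm n ps qs : perm_eq ps qs -> cav n ps = cav n qs.
Proof. by move=> H; apply: eq_cnt => w _; apply: perm_all. Qed.

Theorem theorem3p7 : forall n : nat, 0 < n ->
  let N := 'C(n, 2) + 1 in
  (* (1) *)
  (forall tau : 'S_4,
     contains (oneline tau) [:: 1; 2; 3] || contains (oneline tau) [:: 2; 3; 1] ->
     #|Av n [:: [:: 1; 2; 3]; [:: 2; 3; 1]; oneline tau]| = N) /\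
  (* (2) *)
  (forall a2 tau : seq nat,
     a2 \in [:: [:: 1; 3; 2]; [:: 2; 1; 3]] ->
     tau \in [:: [:: 3; 4; 1; 2]; [:: 4; 2; 3; 1]] ->
     #|Av n [:: [:: 1; 2; 3]; a2; tau]| = N) /\
  (* (3) *)
  #|Av n [:: [:: 1; 3; 2]; [:: 2; 1; 3]; [:: 3; 4; 1; 2]]| = N /\
  (* (4) *)
  (forall tau : seq nat,
     tau \in [:: [:: 1; 2; 3; 4]; [:: 2; 1; 3; 4]; [:: 3; 1; 2; 4]; [:: 3; 2; 1; 4]] ->
     #|Av n [:: [:: 1; 3; 2]; [:: 2; 3; 1]; tau]| = N) /\
  (* (5) *)
  #|Av n [:: [:: 2; 1; 3]; [:: 3; 1; 2]; [:: 2; 3; 4; 1]]| = N /\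
  (* (6) *)
  (forall tau : seq nat,
     tau \in [:: [:: 1; 3; 2; 4]; [:: 2; 3; 1; 4]] ->
     #|Av n [:: [:: 2; 1; 3]; [:: 3; 2; 1]; tau]| = N) /\
  (* (7) *)
  #|Av n [:: [:: 2; 1; 3]; [:: 1; 3; 2]; [:: 4; 3; 2; 1]]| = N.
Proof.
move=> n n0 N; have Av_cav ps : #|Av n ps| = cav n ps by exact: card_Av.
do ![split].
- by move=> tau Htau; rewrite Av_cav cav_absorb // cav_123_231.
- move=> a2 tau; rewrite !inE => /orP[] /eqP -> /orP[] /eqP ->; rewrite Av_cav.
  + exact: cav_123_132_3412.
  (* Reverse-complement fixes 123, 3412 and 4231 and exchanges 132 with 213. *)
  + by rewrite cav_rc // (cav_123_213_4231 n0).
  + by rewrite cav_rc // cav_123_132_3412.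
  + exact: cav_123_213_4231.
- by rewrite Av_cav cav_132_213_3412.
- move=> tau; rewrite !inE => /or4P[] /eqP ->; rewrite Av_cav.
  + exact: (@cav_132_231_S4 n [:: 1; 2; 3]).
  + exact: (@cav_132_231_S4 n [:: 2; 1; 3]).
  + exact: (@cav_132_231_S4 n [:: 3; 1; 2]).
  + exact: (@cav_132_231_S4 n [:: 3; 2; 1]).
(* Reverse-complement sends 213, 312, 2341 to 132, 231, 4123. *)
- by rewrite Av_cav cav_rc // (cav_132_231_4123 n0).
(* Both values of [tau] contain 213, so the class is that of 213 and 321, the reverse-complement of
   132 and 321. *)
- move=> tau Htau; rewrite Av_cav cav_absorb.
    by rewrite cav_rc // cav_132_321.
  by move: Htau; rewrite !inE => /orP[] /eqP ->; rewrite !containsE.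
- rewrite Av_cav /N -(cav_132_213_4321 n0); apply: cav_perm.
  by apply/permPl; apply: (perm_catCA [:: _] [:: _]).
Qed.
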